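(* Let $k\ge1$. The probability mass function $g_n^{(III)}(x)=P(N_n^{(III)}=x)$ satisfies, for $n>k$, the recursive scheme $$g_{n}^{(III)}(x)=g_{n-1}^{(III)}(x)+p\,g_{n-1}^{(III)}(x-1)-p\,g_{n-2}^{(III)}(x-1)-p^{k}q\,g_{n-k-1}^{(III)}(x)+p^{k}q\,g_{n-k-1}^{(III)}(x-1),$$ with initial conditions $g_{n}^{(III)}(x)=0$ for $x<0$ and, when $n\ge k$, also for $x>n-k+1$; $g_{n}^{(III)}(x)=\delta_{0,x}$ for $0\le n<k$; and $g_{k}^{(III)}(0)=1-p^{k}$, $g_{k}^{(III)}(1)=p^{k}$, $g_{k}^{(III)}(x)=0$ for $x>1$.
   Context: $(X_i)_{i\ge1}$ is an infinite sequence of independent Bernoulli trials with $P(X_i=1)=p$, $0<p<1$, and $P(X_i=0)=q=1-p$. $N_n^{(III)}$ is the number of success runs of length $k$ in the first $n$ trials under overlapping counting, i.e. the number of indices $j$ with $k\le j\le n$ and $X_{j-k+1}=\cdots=X_j=1$ (a maximal block of $m\ge k$ ones contributes $m-k+1$). $x$ is an integer; $\delta_{0,x}$ is the Kronecker delta. *)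

(* Defs.v *)
From HB Require Import structures.
From mathcomp Require Import all_boot all_order all_algebra finmap.
From mathcomp Require Import all_classical all_reals all_analysis.

Set Implicit Arguments.
Unset Strict Implicit.
Unset Printing Implicit Defensive.

Import Order.TTheory GRing.Theory Num.Theory.
Local Open Scope classical_set_scope.
Local Open Scope ring_scope.

(* Mutual independence of the subfamily (X i), i in I : the product rule holds
   for every finite set J of indices in I and all measurable sets B i. *)
Definition mutual_independent_RV d d' (T : measurableType d)
    (T' : measurableType d') (R : realType) (P : probability T R)
    (I : set nat) (X : nat -> {RV P >-> T'}) : Prop :=
  forall (J : {fset nat}) (B : nat -> set T'),
    [set` J] `<=` I ->
    (forall i, i \in J -> measurable (B i)) ->
    P (\bigcap_(i in [set` J]) (X i @^-1` B i)) =
      (\prod_(i <- J) P (X i @^-1` B i))%E.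

(* The sequence is indexed from 1, as X_1, X_2, ...; the value X 0 plays no
   role. *)
Definition bernoulli_trials d (T : measurableType d) (R : realType)
    (P : probability T R) (p : R) (X : nat -> {RV P >-> R}) : Prop :=
  mutual_independent_RV [set i | (1 <= i)%N] X /\
  (forall i, (1 <= i)%N ->
    P [set w | X i w = 1] = p%:E /\ P [set w | X i w = 0] = (1 - p)%:E).

(* x (j - k + 1) = ... = x j = 1 (meaningful for k <= j). *)
Definition success_run_at (R : realType) (x : nat -> R) (k j : nat) : bool :=
  all (fun i => x i == 1) (index_iota (j - k).+1 j.+1).

(* A run is counted by its last index j; overlapping runs all count. *)
Definition overlapping_runs (R : realType) (x : nat -> R) (k n : nat) : nat :=
  (\sum_(k <= j < n.+1) success_run_at x k j)%N.

Definition overlapping_runs_pmf d (T : measurableType d) (R : realType)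
    (P : probability T R) (X : nat -> {RV P >-> R}) (k n : nat) (x : int) : R :=
  fine (P [set w | (overlapping_runs (fun i => X i w) k n)%:Z = x]).

(* Main.v *)
(* Let r_n(x) be the probability that a run ends at trial n and that x runs end
   before it.  Counting with or without the last trial gives
     g_n(x) = g_{n-1}(x) - r_n(x) + r_n(x-1),
   and looking at trial n-k gives
     r_n(x) = p r_{n-1}(x-1) + p^k q g_{n-k-1}(x)   for n > k.
   Substituting the second identity in the first, and then the first at n-1 to
   eliminate r_{n-1}, yields the recurrence. *)
Require Import Defs.
From HB Require Import structures.
From mathcomp Require Import all_boot all_order all_algebra finmap.
From mathcomp Require Import all_classical all_reals all_analysis.
From mathcomp Require Import zify ring.

Set Implicit Arguments.
Unset Strict Implicit.
Unset Printing Implicit Defensive.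

Import Order.TTheory GRing.Theory Num.Theory.
Local Open Scope classical_set_scope.
Local Open Scope ring_scope.

(** * Trials and runs as lists of outcomes *)

(* Outcomes of the first n trials are listed latest first. *)
Definition trial_history (R : realType) (x : nat -> R) (n : nat) : seq bool :=
  [seq x i == 1 | i <- rev (iota 1 n)].

(** Each nonempty suffix of [s] is the history at some trial, so a prefix of [k] ones is a run
    ending at that trial. *)
Fixpoint run_count (k : nat) (s : seq bool) : nat :=
  if s is _ :: s' then (prefix (nseq k true) s + run_count k s')%N else 0%N.

Definition trial_weight (R : realType) (p : R) (b : bool) : R :=
  if b then p else 1 - p.

(** The recursion is on the latest trial, which turns identities between functions of lists into
    identities between probabilities without measure theory. *)
Fixpoint bernoulli_expect (R : realType) (p : R) (n : nat) (f : seq bool -> R)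
    : R :=
  if n is n'.+1 then
    p * bernoulli_expect p n' (fun s => f (true :: s)) +
    (1 - p) * bernoulli_expect p n' (fun s => f (false :: s))
  else f [::].

Definition run_pmf (R : realType) (p : R) (k n : nat) (x : int) : R :=
  bernoulli_expect p n (fun s => ((run_count k s)%:Z == x)%:R).

(** This is r_n(x): [behead] drops the latest trial, so only earlier runs are counted. *)
Definition new_run_pmf (R : realType) (p : R) (k n : nat) (x : int) : R :=
  bernoulli_expect p n (fun s => (prefix (nseq k true) s)%:R *
    ((run_count k (behead s))%:Z == x)%:R).

Lemma trial_historyS (R : realType) (x : nat -> R) (n : nat) :
  trial_history x n.+1 = (x n.+1 == 1) :: trial_history x n.
Proof.
by rewrite /trial_history -[in iota 1 _](addn1 n) iotaD rev_cat /= add1n.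
Qed.

Lemma run_count_cons (k : nat) (b : bool) (s : seq bool) :
  run_count k (b :: s) = (prefix (nseq k true) (b :: s) + run_count k s)%N.
Proof. by []. Qed.

Lemma prefix_nseq_short (k : nat) (s : seq bool) :
  (size s < k)%N -> prefix (nseq k true) s = false.
Proof.
by apply: contraTF => /size_prefix; rewrite size_nseq leqNgt.
Qed.

(** The entry that follows [c] exists and is [true] or [false]; this is the case split on trial
    n-k. *)
Lemma prefix_rcons_bool (c s : seq bool) : (size c < size s)%N ->
  prefix c s = (prefix (rcons c true) s + prefix (rcons c false) s)%N :> nat.
Proof.
elim: c s => [|b c IH] [|b' s] //=; first by rewrite prefix0s; case: b'.
by move=> /IH; case: eqP.
Qed.

Lemma prefix_trial_history (R : realType) (x : nat -> R) (k n : nat) :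
  (k <= n)%N -> prefix (nseq k true) (trial_history x n) = success_run_at x k n.
Proof.
rewrite /success_run_at; elim: k n => [|k IH] [|n] // kn.
  by rewrite prefix0s subn0 /index_iota subnn.
rewrite trial_historyS /= IH // subSS /index_iota.
rewrite (_ : (n.+2 - (n - k).+1 = (n.+1 - (n - k).+1) + 1)%N); last by lia.
rewrite iotaD all_cat /= andbT andbC.
rewrite (_ : (_ + (n.+1 - _) = n.+1)%N); last by lia.
by congr (_ && _); rewrite -?eqb_id ?[true == _]eq_sym //; case: (_ == 1).
Qed.

(** Trial [n.+1] adds a run exactly when its history starts with [k] ones. For [k = 0] the sum would
    also count the empty run at [j = 0]. *)
Lemma overlapping_runsE (R : realType) (x : nat -> R) (k n : nat) :
  (1 <= k)%N -> overlapping_runs x k n = run_count k (trial_history x n).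
Proof.
move=> k1; rewrite /overlapping_runs; elim: n => [|n IH].
  by rewrite big_geq.
rewrite trial_historyS run_count_cons -trial_historyS -IH.
have [kn|nk] := leqP k n.+1.
  by rewrite big_nat_recr //= addnC prefix_trial_history.
rewrite !big_geq ?(ltnW nk)// addn0 prefix_nseq_short //.
by rewrite size_map size_rev size_iota.
Qed.

Lemma overlapping_runs_le (R : realType) (x : nat -> R) (k n : nat) :
  (overlapping_runs x k n <= n.+1 - k)%N.
Proof.
rewrite /overlapping_runs -[leqRHS]muln1 -sum_nat_const_nat.
by apply: leq_sum => i _; apply: leq_b1.
Qed.

(** * Expectation over finitely many independent trials *)

Section expectation.
Variables (R : realType) (p : R).
Implicit Types (f h : seq bool -> R) (n m : nat).

Lemma eq_bernoulli_expect n f h :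
  (forall s, size s = n -> f s = h s) ->
  bernoulli_expect p n f = bernoulli_expect p n h.
Proof.
elim: n f h => [|n IH] f h fh /=; first exact: fh.
by congr (_ * _ + _ * _); apply: IH => s sn; apply: fh; rewrite /= sn.
Qed.

Lemma bernoulli_expectD n f h :
  bernoulli_expect p n (fun s => f s + h s) =
  bernoulli_expect p n f + bernoulli_expect p n h.
Proof. by elim: n f h => [|n IH] f h //=; rewrite !IH; ring. Qed.

Lemma bernoulli_expectN n f :
  bernoulli_expect p n (fun s => - f s) = - bernoulli_expect p n f.
Proof. by elim: n f => [|n IH] f //=; rewrite !IH; ring. Qed.

Lemma bernoulli_expect_cst n (c : R) : bernoulli_expect p n (fun=> c) = c.
Proof. by elim: n => [|n IH] //=; rewrite !IH; ring. Qed.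

Lemma bernoulli_expect_behead n f :
  bernoulli_expect p n.+1 (fun s => f (behead s)) = bernoulli_expect p n f.
Proof. by rewrite /= -mulrDl subrKC mul1r. Qed.

(** Independence in the finite model: fixing the latest outcomes costs their weights and leaves the
    earlier trials free. *)
Lemma bernoulli_expect_prefix c m h :
  bernoulli_expect p (size c + m) (fun s => (prefix c s)%:R * h s) =
  (\prod_(b <- c) trial_weight p b) *
  bernoulli_expect p m (fun s => h (c ++ s)).
Proof.
elim: c h => [|b c IH] h /=.
  rewrite big_nil mul1r; apply: eq_bernoulli_expect => s _.
  by rewrite prefix0s mul1r.
rewrite big_cons -mulrA -(IH (fun s => h (b :: s))).
have E0 n f : bernoulli_expect p n (fun s => 0 * f s) = 0.
  rewrite -[RHS](bernoulli_expect_cst n 0).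
  by apply: eq_bernoulli_expect => s; rewrite mul0r.
by case: b => /=; rewrite E0 mulr0 ?addr0 ?add0r.
Qed.

Lemma prod_trial_weight_nseq k :
  \prod_(b <- nseq k true) trial_weight p b = p ^+ k.
Proof. by rewrite big_nseq -Monoid.iteropE. Qed.

End expectation.

(** No run crosses the failure, and the [j < k] successes after it are too few to form one. *)
Lemma run_count_fail (k j : nat) (s : seq bool) :
  (j < k)%N -> run_count k (nseq j true ++ false :: s) = run_count k s.
Proof.
have nprefix i l : (i < l)%N ->
    prefix (nseq l true) (nseq i true ++ false :: s) = false.
  by elim: i l => [|i IH] [|l] // /IH.
elim: j => [|j IH] jk; first by case: k jk.
by rewrite run_count_cons (nprefix j.+1 k jk) IH // ltnW.
Qed.

Lemma run_count_short (k : nat) (s : seq bool) :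
  (size s < k)%N -> run_count k s = 0%N.
Proof.
elim: s => // b s IH sk.
by rewrite run_count_cons prefix_nseq_short // IH // ltnW.
Qed.

(** * The recurrence in the finite model *)

Section recurrence.
Variables (R : realType) (p : R) (k : nat).
Implicit Types (n m : nat) (x : int).

Hypothesis k_gt0 : (0 < k)%N.

(** A run at the last trial raises the count by one; otherwise the count is unchanged. *)
Lemma run_pmfS n x :
  run_pmf p k n.+1 x =
  run_pmf p k n x - new_run_pmf p k n.+1 x + new_run_pmf p k n.+1 (x - 1).
Proof.
rewrite /run_pmf -(bernoulli_expect_behead p n) /new_run_pmf.
rewrite -bernoulli_expectN -!bernoulli_expectD; apply: eq_bernoulli_expect.
case=> [|b s] // _.
rewrite run_count_cons [behead _]/=.
case: (prefix _ _); rewrite ?mul0r ?mul1r ?subr0 ?addr0 // subrr add0r.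
by congr ((nat_of_bool _)%:R); lia.
Qed.

(** Only [k] successes give a run at trial [k], and the [k - 1] trials before it are too few for
    another. *)
Lemma new_run_pmfk x : new_run_pmf p k k x = p ^+ k * (x == 0)%:R.
Proof.
rewrite /new_run_pmf -[X in bernoulli_expect p X](addn0 k).
rewrite -[X in (X + 0)%N](size_nseq k true) bernoulli_expect_prefix.
rewrite prod_trial_weight_nseq /= cats0 eq_sym.
by rewrite run_count_short // size_behead size_nseq prednK.
Qed.

(* A run ending at trial n+1 either extends a run ending at trial n, or starts
   right after a failure at trial n+1-k; in the second case the runs before
   trial n+1 are those of the first n-k trials. *)
Lemma new_run_pmfS n x : (k <= n)%N ->
  new_run_pmf p k n.+1 x =
  p * new_run_pmf p k n (x - 1) + p ^+ k * (1 - p) * run_pmf p k (n - k) x.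
Proof.
case: k k_gt0 => // j _ jn; pose c := rcons (nseq j true) false.
have nseqE : nseq j.+1 true = rcons (nseq j true) true.
  by rewrite -cats1 -[j.+1]addn1 nseqD.
have nE : n = (size c + (n - j.+1))%N by rewrite size_rcons size_nseq subnKC.
(* The latest trial must be a success, whence the factor [p]; the failure branch vanishes. *)
have -> : new_run_pmf p j.+1 n.+1 x = p * bernoulli_expect p n (fun s =>
    (prefix (nseq j true) s)%:R * ((run_count j.+1 s)%:Z == x)%:R).
  rewrite -[RHS]addr0 -[X in _ + X](mulr0 (1 - p)).
  congr (_ + _ * _); rewrite -[RHS](bernoulli_expect_cst p n 0).
  by apply: eq_bernoulli_expect => s _; rewrite mul0r.
have -> : p ^+ j.+1 * (1 - p) * run_pmf p j.+1 (n - j.+1) x =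
    p * bernoulli_expect p n (fun s =>
      (prefix c s)%:R * ((run_count j.+1 s)%:Z == x)%:R).
  rewrite [X in bernoulli_expect p X]nE bernoulli_expect_prefix.
  rewrite /c -cats1 big_cat big_seq1 prod_trial_weight_nseq exprS.
  rewrite !mulrA; congr (_ * _).
  apply: eq_bernoulli_expect => s _.
  by rewrite -catA run_count_fail.
rewrite -mulrDr -bernoulli_expectD; congr (_ * _).
apply: eq_bernoulli_expect => s sn.
(* Before the [j] successes comes either a success, completing a run at trial [n], or a failure,
   giving [c]. *)
rewrite (prefix_rcons_bool (c := nseq j true)) ?size_nseq ?sn // -nseqE -/c.
rewrite natrD mulrDl; congr (_ + _).
case: s sn => [|b s] _; first by rewrite !mul0r.
(* The run ending at trial [n] is itself counted in [s], whence [x - 1]. *)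
rewrite run_count_cons; case: (prefix _ _); rewrite ?mul0r ?mul1r //.
by congr ((nat_of_bool _)%:R); rewrite [behead _]/=; lia.
Qed.

Lemma run_pmf_rec n x : (k < n)%N ->
  run_pmf p k n x = run_pmf p k (n - 1) x + p * run_pmf p k (n - 1) (x - 1)
    - p * run_pmf p k (n - 2) (x - 1)
    - p ^+ k * (1 - p) * run_pmf p k (n - k - 1) x
    + p ^+ k * (1 - p) * run_pmf p k (n - k - 1) (x - 1).
Proof.
case: n => [|[|n]]; [by []|by case: k k_gt0 => [|[]]|]; rewrite ltnS => kn.
rewrite run_pmfS (new_run_pmfS x kn) (new_run_pmfS (x - 1) kn).
rewrite subnAC !subn1 subn2 /=.
(* Expanding at the previous trial and at [x - 1] cancels the remaining [new_run_pmf] terms. *)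
by rewrite [run_pmf p k n.+1 (x - 1)]run_pmfS; ring.
Qed.

End recurrence.

Lemma run_pmf_lt (R : realType) (p : R) (k n : nat) (x : int) :
  (n < k)%N -> run_pmf p k n x = (x == 0)%:R.
Proof.
move=> nk; rewrite -[RHS](bernoulli_expect_cst p n).
apply: eq_bernoulli_expect => s sn.
by rewrite run_count_short ?sn // eq_sym.
Qed.

Lemma run_pmf_init (R : realType) (p : R) (k : nat) (x : int) : (0 < k)%N ->
  run_pmf p k k x =
  (x == 0)%:R - p ^+ k * (x == 0)%:R + p ^+ k * (x - 1 == 0)%:R.
Proof.
by case: k => // j _; rewrite run_pmfS // !new_run_pmfk // run_pmf_lt.
Qed.

(** * Transfer to the probability space *)

Section trials.
Variables (d : measure_display) (T : measurableType d) (R : realType).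
Variables (P : probability T R) (p : R) (X : nat -> {RV P >-> R}).
Hypothesis trialsX : bernoulli_trials p X.

(* A failure is recorded as [X i w != 1]; this differs from [X i w = 0] only on
   a null set. *)
Let outcome (b : bool) : set R := if b then [set 1] else ~` [set 1].
Let hist n w := trial_history (fun i => X i w) n.

Lemma preimage_outcome i b :
  X i @^-1` outcome b = [set w | (X i w == 1) = b].
Proof.
case: b; apply/seteqP; split => w /=.
- by move=> ->; rewrite eqxx.
- by move/eqP.
- by move/eqP/negbTE.
- by move/negbT/eqP.
Qed.

Lemma measurable_outcome b : measurable (outcome b).
Proof. by case: b => //=; apply: measurableC. Qed.

Lemma measurable_preimage_outcome i b : measurable (X i @^-1` outcome b).
Proof.
rewrite -[_ @^-1` _]setTI; apply: measurable_funP => //.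
exact: measurable_outcome.
Qed.

Lemma probability_outcome i b : (1 <= i)%N ->
  P (X i @^-1` outcome b) = (trial_weight p b)%:E.
Proof.
move=> i1; have [XE _] := trialsX.2 i i1.
by case: b => //; rewrite /outcome -preimage_setC probability_setC ?XE //.
Qed.

Lemma hist_split n (f : seq bool -> bool) :
  [set w | f (hist n.+1 w)] =
  ([set w | f (true :: hist n w)] `&` X n.+1 @^-1` outcome true) `|`
  ([set w | f (false :: hist n w)] `&` X n.+1 @^-1` outcome false).
Proof.
rewrite !preimage_outcome; apply/seteqP; split => w /=.
  by rewrite /hist trial_historyS; case: (_ == 1) => ?; [left|right].
by rewrite /hist trial_historyS => -[] [? ->].
Qed.

Lemma measurable_hist n (f : seq bool -> bool) :
  measurable [set w | f (hist n w)].
Proof.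
elim: n f => [|n IH] f.
  case fE: (f [::]).
    by rewrite (_ : mkset _ = setT)//; apply/seteqP; split.
  by rewrite (_ : mkset _ = set0)//; apply/seteqP; split => w //=; rewrite fE.
rewrite hist_split; apply: measurableU; apply: measurableI.
- exact: (IH (fun s => f (true :: s))).
- exact: measurable_preimage_outcome.
- exact: (IH (fun s => f (false :: s))).
- exact: measurable_preimage_outcome.
Qed.

(* The cylinder over the later indices J is what makes the induction on n go
   through: conditioning on trial n+1 moves the index n+1 into J. *)
Lemma probability_hist_cylinder n (f : seq bool -> bool) (J : {fset nat})
    (b : nat -> bool) : (forall i, i \in J -> (n < i)%N) ->
  P ([set w | f (hist n w)] `&`
     \bigcap_(i in [set` J]) (X i @^-1` outcome (b i))) =
  (bernoulli_expect p n (fun s => (f s)%:R) *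
   \prod_(i <- J) trial_weight p (b i))%:E.
Proof.
elim: n f J b => [|n IH] f J b nJ.
  (* With an empty history the event is empty or the whole cylinder, and mutual independence factors
     the latter. *)
  rewrite /=; case fE: (f [::]); last first.
    rewrite (_ : mkset _ = set0) ?set0I ?measure0 ?mul0r //.
    by apply/seteqP; split => w //=; rewrite fE.
  rewrite (_ : mkset _ = setT); last by apply/seteqP; split.
  rewrite setTI mul1r trialsX.1; last 2 first.
  - by move=> i /= /nJ.
  - by move=> i _; exact: measurable_outcome.
  rewrite -prodEFin big_seq [RHS]big_seq; apply: eq_bigr => i iJ.
  by rewrite probability_outcome // nJ.
have nJ' : n.+1 \notin J by apply/negP => /nJ; rewrite ltnn.
have step c : P ([set w | f (c :: hist n w)] `&` X n.+1 @^-1` outcome c `&`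
      \bigcap_(i in [set` J]) (X i @^-1` outcome (b i))) =
    (trial_weight p c * bernoulli_expect p n (fun s => (f (c :: s))%:R) *
     \prod_(i <- J) trial_weight p (b i))%:E.
  (* [b'] prescribes [c] at the new index and agrees with [b] on [J], so both constraints merge into
     one cylinder. *)
  pose b' i := if i == n.+1 then c else b i.
  have b'E i : i \in J -> b' i = b i.
    by move=> iJ; rewrite /b' ifN //; apply: contraNneq nJ' => <-.
  have -> : [set w | f (c :: hist n w)] `&` X n.+1 @^-1` outcome c `&`
      \bigcap_(i in [set` J]) (X i @^-1` outcome (b i)) =
    [set w | f (c :: hist n w)] `&`
      \bigcap_(i in [set` (n.+1 |` J)%fset]) (X i @^-1` outcome (b' i)).
    rewrite -setIA; congr (_ `&` _).
    rewrite set_fsetU set_fset1 bigcap_setU bigcap_set1 {1}/b' eqxx.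
    by congr (_ `&` _); apply: eq_bigcapr => i iJ; rewrite b'E.
  rewrite (IH (fun s => f (c :: s))); last first.
    by move=> i; rewrite in_fset1U => /predU1P[->//|/nJ/ltnW].
  rewrite big_fsetU1 //= {1}/b' eqxx.
  rewrite [X in _ * (_ * X)](_ : _ = \prod_(i <- J) trial_weight p (b i)).
    by congr (_%:E); ring.
  by rewrite big_seq [RHS]big_seq; apply: eq_bigr => i iJ; rewrite b'E.
have mstep c : measurable ([set w | f (c :: hist n w)] `&`
    X n.+1 @^-1` outcome c `&`
    \bigcap_(i in [set` J]) (X i @^-1` outcome (b i))).
  apply: measurableI; last first.
    apply: fin_bigcap_measurable => // i _.
    exact: measurable_preimage_outcome.
  apply: measurableI; first exact: (measurable_hist n (fun s => f (c :: s))).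
  exact: measurable_preimage_outcome.
(* The two outcomes of trial [n.+1] give disjoint pieces, matching the recursion of
   [bernoulli_expect]. *)
rewrite hist_split setIUl measureU //; last first.
  by apply/seteqP; split => w //= -[[[_ +] _] [[_ +] _]].
by rewrite [X in (X + _)%E]step [X in (_ + X)%E]step -EFinD /= -mulrDl.
Qed.

(** The cylinder over no index is the whole space, so the cylinder formula gives the law of the
    history. *)
Lemma overlapping_runs_pmfE k n x : (1 <= k)%N ->
  overlapping_runs_pmf X k n x = run_pmf p k n x.
Proof.
move=> k1; rewrite /overlapping_runs_pmf /run_pmf.
have -> : [set w | (overlapping_runs (fun i => X i w) k n)%:Z = x] =
    [set w | (run_count k (hist n w))%:Z == x] `&`
    \bigcap_(i in [set` (fset0 : {fset nat})]) (X i @^-1` outcome true).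
  rewrite set_fset0 bigcap_set0 setIT; apply/seteqP; split => w /=;
    by rewrite overlapping_runsE // => /eqP.
rewrite (probability_hist_cylinder (fun s => (run_count k s)%:Z == x)) //.
by rewrite big_seq_fset0 mulr1.
Qed.

End trials.

Theorem theorem4p7 (d : measure_display) (T : measurableType d) (R : realType)
    (P : probability T R) (p q : R) (X : nat -> {RV P >-> R}) (k : nat)
    (g := overlapping_runs_pmf X k)
    (p_gt0 : 0 < p) (p_lt1 : p < 1) (qE : q = 1 - p)
    (trialsX : bernoulli_trials p X) (k_ge1 : (1 <= k)%N) :
  (forall (n : nat) (x : int), (k < n)%N ->
     g n x = g (n - 1)%N x + p * g (n - 1)%N (x - 1)
             - p * g (n - 2)%N (x - 1)
             - p ^+ k * q * g (n - k - 1)%N x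
             + p ^+ k * q * g (n - k - 1)%N (x - 1)) /\
  (forall (n : nat) (x : int), x < 0 -> g n x = 0) /\
  (forall (n : nat) (x : int), (k <= n)%N -> n%:Z - k%:Z + 1 < x -> g n x = 0) /\
  (forall (n : nat) (x : int), (n < k)%N -> g n x = (x == 0)%:R) /\
  g k 0 = 1 - p ^+ k /\
  g k 1 = p ^+ k /\
  (forall x : int, 1 < x -> g k x = 0).
Proof.
have gE n x : g n x = run_pmf p k n x by exact: overlapping_runs_pmfE.
(* Outside the range from 0 to [n.+1 - k] the event is empty; the truncated subtraction is exact for
   [k <= n], and the bound is 1 at [n = k]. *)
have g_out n x : x < 0 \/ (n.+1 - k)%N%:Z < x -> g n x = 0.
  move=> xP; rewrite /g /overlapping_runs_pmf (_ : mkset _ = set0) ?measure0 //.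
  apply/seteqP; split => w //= xE.
  by have := overlapping_runs_le (fun i => X i w) k n; lia.
split; first by move=> n x kn; rewrite !gE qE run_pmf_rec.
split; first by move=> n x x0; apply: g_out; left.
split; first by move=> n x kn nx; apply: g_out; right; lia.
split; first by move=> n x nk; rewrite gE run_pmf_lt.
split; first by rewrite gE run_pmf_init // eqxx /= mulr1 mulr0 addr0.
split.
  by rewrite gE run_pmf_init // subrr eqxx /= mulr0 mulr1 subrr add0r.
by move=> x x1; apply: g_out; right; lia.
Qed.
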